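(* Let $a\in(0,1)$ and $p=\frac{1-a}{a}\in(0,\infty)$. For any non-negative $F\in L^a(\mathbb{R}^n)$ that is not zero almost everywhere, let $\phi=-a\log F$. Then $$\frac{\|F\|_{L^a}}{\|\mathcal{L}F\|_{L^{\frac{a}{a-1}}}}=p^{np}\,\mathcal{M}_p(\phi)^p.$$
   Context: For non-negative measurable $G$ and a nonzero real exponent $r$ (possibly with $r<1$ or negative), $\|G\|_{L^r}=\left(\int_{\mathbb{R}^n}G(x)^r\,dx\right)^{1/r}$, with the usual conventions $1/0=\infty$, $1/\infty=0$; $F\in L^a$ means $\|F\|_{L^a}<\infty$. The Laplace transform is $\mathcal{L}F(y)=\int_{\mathbb{R}^n}F(x)e^{\langle x,y\rangle}\,dx\in[0,\infty]$. With $\log 0=-\infty$, $\phi$ takes values in $\mathbb{R}\cup\{\infty\}$. For $f:\mathbb{R}^n\to\mathbb{R}\cup\{\infty\}$ let $V(f)=\int_{\mathbb{R}^n}e^{-f(x)}\,dx$ (with $e^{-\infty}=0$). For $f$ with $0<V(f)<\infty$, the $L^p$-Legendre transform is $$f^{*,p}(y)=\frac1p\log\int_{\mathbb{R}^n}e^{p(\langle x,y\rangle-f(x))}\frac{e^{-f(x)}\,dx}{V(f)},$$ which may take the value $\infty$, and the $L^p$-Mahler integral is $\mathcal{M}_p(f)=V(f)V(f^{*,p})\in[0,\infty]$. *)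

(* Defs.v *)
From HB Require Import structures.
From mathcomp Require Import all_boot all_order all_algebra.
From mathcomp Require Import all_classical all_reals all_analysis.
Set Implicit Arguments.
Unset Strict Implicit.
Unset Printing Implicit Defensive.
Import Order.TTheory GRing.Theory Num.Theory.

Local Open Scope classical_set_scope.
Local Open Scope ring_scope.
Local Open Scope ereal_scope.

(* The library's sigma-algebra on tuples is the product one, so that this is
   R^n with its Borel sets. *)
Notation borelRn R n := (n.-tuple (measurableTypeR R)).

Section consRn.
Context {R : realType} {n : nat}.

Definition consRn (z : measurableTypeR R * borelRn R n) : borelRn R n.+1 :=
  [tuple of z.1 :: z.2].

Let measurable_consRn : measurable_fun setT consRn.
Proof. exact: measurable_cons. Qed.

HB.instance Definition _ := isMeasurableFun.Build _ _ _ _ consRn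
  measurable_consRn.

End consRn.

Section borel_lebesgueS.
Context {R : realType} {n : nat}.
Variable mu : {measure set (borelRn R n) -> \bar R}.

(* [\x^] needs only its left factor to be sigma-finite, so that the recursion
   defining [borel_lebesgue] can stay within measures. *)
Definition borel_lebesgueS : set (borelRn R n.+1) -> \bar R :=
  pushforward (@lebesgue_measure R \x^ mu) consRn.

Let borel_lebesgueS0 : borel_lebesgueS set0 = 0.
Proof. exact: measure0. Qed.

Let borel_lebesgueS_ge0 A : 0 <= borel_lebesgueS A.
Proof. exact: measure_ge0. Qed.

Let borel_lebesgueS_sigma_additive : semi_sigma_additive borel_lebesgueS.
Proof. exact: measure_semi_sigma_additive. Qed.

HB.instance Definition _ := isMeasure.Build _ _ _ borel_lebesgueS
  borel_lebesgueS0 borel_lebesgueS_ge0 borel_lebesgueS_sigma_additive.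

End borel_lebesgueS.

Section LebesgueRn.
Context {R : realType}.

(* Lebesgue measure on the Borel sets of R^n, as the n-fold product of the
   one-dimensional Lebesgue measure. *)
Fixpoint borel_lebesgue (n : nat) : {measure set (borelRn R n) -> \bar R} :=
  match n return {measure set (borelRn R n) -> \bar R} with
  | 0 => \d_([tuple] : borelRn R 0)
  | m.+1 => borel_lebesgueS (borel_lebesgue m)
  end.

End LebesgueRn.

(* R^n with its Lebesgue-measurable sets: the Caratheodory sets of the outer
   measure induced by [borel_lebesgue]. *)
Definition Rn (R : realType) (n : nat) : Type :=
  caratheodory_type (mu_ext (@borel_lebesgue R n)).

HB.instance Definition _ (R : realType) (n : nat) := Measurable.on (Rn R n).

Section mahler.
Context {R : realType} {n : nat}.

Definition lebesgueRn : set (Rn R n) -> \bar R :=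
  @completed_measure_extension _ _ _ (borel_lebesgue n).

HB.instance Definition _ := Measure.on lebesgueRn.

Definition dotRn (x y : Rn R n) : R :=
  (\sum_(i < n) (tnth x i : R) * (tnth y i : R))%R.

(* Powers of x in [0, +oo]. The library's [poweR] has 0 `^ r = 0 and
   +oo `^ r = +oo also for r < 0; here 0^-1 = +oo and +oo^-1 = 0. *)
Definition epow (x : \bar R) (r : R) : \bar R :=
  if (r < 0)%R then (poweR x (- r))^-1 else poweR x r.

Definition normL (r : R) (G : Rn R n -> \bar R) : \bar R :=
  epow (\int[lebesgueRn]_x epow (G x) r) r^-1%R.

Definition laplace (F : Rn R n -> R) (y : Rn R n) : \bar R :=
  \int[lebesgueRn]_x (F x * expR (dotRn x y))%:E.

Definition volume (f : Rn R n -> \bar R) : \bar R :=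
  \int[lebesgueRn]_x expeR (- f x).

Definition Lp_legendre (p : R) (f : Rn R n -> \bar R) (y : Rn R n) : \bar R :=
  p^-1%:E * lne (\int[lebesgueRn]_x
    (expeR (p%:E * ((dotRn x y)%:E - f x)) * (expeR (- f x) / volume f))).

Definition mahler (p : R) (f : Rn R n -> \bar R) : \bar R :=
  volume f * volume (Lp_legendre p f).

End mahler.

(* Main.v *)
Require Import Defs.
From mathcomp Require Import all_boot all_order all_algebra.
From mathcomp Require Import all_classical all_reals all_analysis.
From mathcomp Require Import measurable_realfun ring.
Set Implicit Arguments.
Unset Strict Implicit.
Unset Printing Implicit Defensive.
Import Order.TTheory GRing.Theory Num.Theory.
Local Open Scope classical_set_scope.
Local Open Scope ring_scope.
Local Open Scope ereal_scope.

(** Put v = \int F^a, which is positive and finite, and S c x = c x.  Since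
    e^(-phi) = F^a and a (p + 1) = 1, the product e^(p (<x,y> - phi x)) e^(- phi x)
    in the L^p-Legendre transform is F x e^<x, p y>, whence
    e^(- phi^{*,p}(y)) = (L F (p y) / v)^(-1/p): the exponent r = a / (a - 1) of
    the statement is exactly - 1/p.  Integrating over y and substituting y/p for
    y gives
      M_p(phi) = v^(1 + 1/p) p^(-n) I,   where I = \int (L F)^(-1/p),
    and the p-th power of this is the claim, because a^-1 = p + 1 and
    the norm of L F in L^r is I^(-p).

    The constants are pulled out of every integral and the substitution is
    carried out for arbitrary non-negative integrands
    ([ge0_integralZ], [ge0_integral_scale]), so that the measurability of L F is
    never at stake: such an integral is a supremum over the simple functions
    below the integrand, and both operations carry the simple functions below one
    integrand onto those below the other.

    The substitution itself rests on the scaling law of Lebesgue measure: it is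
    proved on the line by uniqueness, on the Borel sets of R^n by induction on n
    ([borel_lebesgue_scale]), then for the outer measure of any set by scaling
    its covers ([mu_ext_scale]).  It follows that a dilation preserves the
    Caratheodory sets ([measurable_scaleRn]). *)

(** * Integrals of non-negative functions, measurable or not *)

Section nonmeasurable_integrands.
Context d (T : measurableType d) (R : realType).
Variable mu : {measure set T -> \bar R}.
Implicit Types f g : T -> \bar R.

Import HBNNSimple.

Lemma ge0_integral_le_nnsfun f M : (forall x, 0 <= f x) ->
    (forall h : {nnsfun T >-> R}, (forall x, (h x)%:E <= f x) ->
      \int[mu]_x (h x)%:E <= M) ->
  \int[mu]_x f x <= M.
Proof.
move=> f0 hM; rewrite ge0_integralTE//; apply: ge_ereal_sup => /= _ [h hf <-].
by rewrite -integralT_nnsfun; exact: hM.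
Qed.

Lemma ge0_integral_mono f g : (forall x, 0 <= f x) ->
  (forall x, f x <= g x) -> \int[mu]_x f x <= \int[mu]_x g x.
Proof.
move=> f0 fg; have g0 x : 0 <= g x by exact: le_trans (f0 x) (fg x).
apply: ge0_integral_le_nnsfun => // h hf.
rewrite integralT_nnsfun (ge0_integralTE mu g0); apply: ereal_sup_ubound.
by exists h => //= x; exact: le_trans (hf x) (fg x).
Qed.

(** The inequality <= suffices, applied to k and to k^-1.  A simple function h
    below k f is k times the simple function h / k below f, and the homogeneity
    of the integral is known for the measurable function h / k. *)
Lemma ge0_integralZ f (k : R) : (0 < k)%R -> (forall x, 0 <= f x) ->
  \int[mu]_x (k%:E * f x) = k%:E * \int[mu]_x f x.
Proof.
suff le_kf (l : R) g : (0 < l)%R -> (forall x, 0 <= g x) ->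
    \int[mu]_x (l%:E * g x) <= l%:E * \int[mu]_x g x.
  move=> k0 f0; apply/eqP; rewrite eq_le le_kf//=.
  rewrite -lee_pdivlMl//; apply: le_trans (le_kf _ _ _ _) => //.
  - apply: ge0_integral_mono => // x.
    by rewrite muleA -EFinM mulVf ?gt_eqF ?mul1e.
  - by rewrite invr_gt0.
  - by move=> x; rewrite mule_ge0// lee_fin ltW.
move=> l0 g0; apply: ge0_integral_le_nnsfun => [x|h hg].
  by rewrite mule_ge0// lee_fin ltW.
have hE x : (h x)%:E = l%:E * (l^-1 * h x)%:E.
  by rewrite -EFinM mulrA divff ?gt_eqF ?mul1r.
under eq_integral do rewrite hE.
have lh0 x : (0 <= l^-1 * h x)%R by rewrite mulr_ge0// invr_ge0 ltW.
rewrite ge0_integralZl_EFin//; last 3 first.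
- by move=> x _; rewrite lee_fin.
- by apply/measurable_EFinP; exact: measurable_funM.
- exact: ltW.
rewrite lee_pmul2l//; apply: ge0_integral_mono => x; first by rewrite lee_fin.
by rewrite -(@lee_pmul2l _ l%:E)// -hE.
Qed.

End nonmeasurable_integrands.

(** * The dilation by c and Lebesgue measure *)

Definition scaleRn (R : realType) n (c : R) (x : borelRn R n) : borelRn R n :=
  [tuple of map (fun t : measurableTypeR R => (c * (t : R))%R) x].

Section scaleRn_theory.
Context {R : realType}.
Implicit Type c : R.

Lemma scaleRnK n c : c != 0%R ->
  cancel (@scaleRn R n c) (@scaleRn R n c^-1).
Proof.
by move=> c0 x; apply: eq_from_tnth => i; rewrite !tnth_map mulrA mulVf ?mul1r.
Qed.

Lemma measurable_mulR c :
  measurable_fun setT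
    (fun t : measurableTypeR R => (c * (t : R))%R : measurableTypeR R).
Proof. exact: measurable_funM. Qed.

Lemma measurable_scaleRn_borel n c :
  measurable_fun setT (@scaleRn R n c).
Proof.
apply/measurable_fun_tnthP => i.
rewrite (_ : _ \o _ =
    (fun t : measurableTypeR R => (c * (t : R))%R : measurableTypeR R) \o
    (@tnth n (measurableTypeR R) ^~ i)); last first.
  by apply/funext => x /=; rewrite tnth_map.
by apply: measurableT_comp; [exact: measurable_mulR|exact: measurable_tnth].
Qed.

(** Pulling sets back by the dilation and multiplying by c is a measure that
    gives a half-open interval its length, so it is Lebesgue measure. *)
Lemma lebesgue_measure_scale c (A : set (measurableTypeR R)) :
  (0 < c)%R -> measurable A ->
  lebesgue_measure ((fun t : measurableTypeR R => (c * (t : R))%R) @^-1` A) =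
  c^-1%:E * lebesgue_measure A.
Proof.
move=> c0 mA.
pose f (t : measurableTypeR R) : measurableTypeR R := (c * (t : R))%R.
have mf : measurable_fun setT f by exact: measurable_mulR.
pose k : {nonneg R} := NngNum (ltW c0).
have [nu nuE] : exists nu : {measure set (measurableTypeR R) -> \bar R},
    forall B, nu B = pushforward lebesgue_measure f B.
  by unshelve eexists; [exact: (pushforward lebesgue_measure f)|].
have -> : lebesgue_measure A = mscale k nu A.
  apply: lebesgue_measure_unique => //= _ [[a b]] _ <- /=.
  rewrite /mscale/= nuE /pushforward.
  have -> : f @^-1` `]a, b]%classic = `](a / c)%R, (b / c)%R]%classic.
    apply/seteqP; split => t;
    by rewrite /f /= !in_itv /= ltr_pdivrMr// ler_pdivlMr// mulrC.
  rewrite !lebesgue_measure_itv /= !lte_fin ltr_pM2r ?invr_gt0//.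
  case: ifP => _; last by rewrite mule0.
  by rewrite -!EFinB -EFinM mulrBr !(mulrC c) !divfK ?gt_eqF.
by rewrite /mscale /= nuE /pushforward muleA -EFinM mulVf ?gt_eqF// mul1e.
Qed.

(** The measure in dimension n + 1 integrates the length of the sections.  The
    section of the preimage of A above y is the preimage of the section of A
    above c y, which yields one factor c^-1; integrating over y yields the
    others, by the induction hypothesis. *)
Lemma borel_lebesgue_scale n c (A : set (borelRn R n)) :
  (0 < c)%R -> measurable A ->
  borel_lebesgue n (@scaleRn R n c @^-1` A) =
  (c^-1 ^+ n)%:E * borel_lebesgue n A.
Proof.
move=> c0; elim: n A => [|n IH] A mA.
  rewrite expr0 mul1e /= !diracE; congr (_%:R%:E); congr (nat_of_bool _).
  apply/idP/idP; rewrite !inE /=; rewrite (_ : scaleRn _ _ = [tuple]) //;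
  exact: val_inj.
have mB : measurable (consRn @^-1` A).
  by rewrite -[X in measurable X]setTI; apply: (measurable_funP (@consRn R n)).
have -> : borel_lebesgue n.+1 (scaleRn c @^-1` A) =
  \int[borel_lebesgue n]_y (c^-1%:E *
     lebesgue_measure (ysection (consRn @^-1` A) (scaleRn c y))).
  rewrite /= /borel_lebesgueS /pushforward /product_measure2.
  apply: eq_integral => y _.
  rewrite -lebesgue_measure_scale//; last exact: measurable_ysection.
  congr lebesgue_measure; apply/seteqP; split => t /=;
  by rewrite /ysection /= !inE /=; congr A; apply: val_inj.
pose f (y : borelRn R n) := lebesgue_measure (ysection (consRn @^-1` A) y).
have mf : measurable_fun setT f by exact: measurable_fun_ysection.
have k0 : (0 <= c^-1 ^+ n)%R by rewrite exprn_ge0// invr_ge0 ltW.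
pose k : {nonneg R} := NngNum k0.
rewrite ge0_integralZ ?invr_gt0//.
rewrite -[X in _ * X](@ge0_integral_pushforward _ _ _ _ _ _
  (@measurable_scaleRn_borel n c) _ setT f) //.
rewrite (@eq_measure_integral _ _ _ _ (mscale k (borel_lebesgue n))); last first.
- by move=> mS B mB' _; rewrite /mscale /= /pushforward IH.
- exact: measurable_scaleRn_borel.
- by rewrite ge0_integral_mscale// muleA -EFinM exprS.
Qed.

End scaleRn_theory.

Section lebesgueRn_scale.
Context {R : realType} {n : nat}.
Implicit Types (c : R) (A : set (borelRn R n)).

Local Notation mu_ext := (mu_ext (@borel_lebesgue R n)).

Let preimage_scaleRnK c A : c != 0%R ->
  @scaleRn R n c^-1 @^-1` (@scaleRn R n c @^-1` A) = A.
Proof.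
move=> c0; apply/seteqP; split => x /=;
by rewrite -{1}(invrK c) scaleRnK// invr_eq0.
Qed.

(** A countable Borel cover of B pulls back to one of the preimage of B, with
    total mass multiplied by e^-n.  This gives <= for every dilation, and the
    inverse dilation turns it into an equality. *)
Lemma mu_ext_scale c A : (0 < c)%R ->
  mu_ext (@scaleRn R n c @^-1` A) = (c^-1 ^+ n)%:E * mu_ext A.
Proof.
suff le_ext (e : R) B : (0 < e)%R ->
    mu_ext (@scaleRn R n e @^-1` B) <= (e^-1 ^+ n)%:E * mu_ext B.
  move=> c0; apply/eqP; rewrite eq_le le_ext//=.
  have cn0 : (0 < c ^+ n)%R by rewrite exprn_gt0.
  rewrite exprVn lee_pdivrMl//.
  rewrite -{1}(preimage_scaleRnK A (lt0r_neq0 c0)).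
  by apply: le_trans (le_ext _ _ _) _; rewrite ?invr_gt0// invrK.
move=> e0; have en0 : (0 < e ^+ n)%R by rewrite exprn_gt0.
rewrite exprVn -lee_pdivrMl ?invr_gt0// invrK.
apply: le_ereal_inf_tmp => _ [/= G [mG BG] <-].
rewrite -lee_pdivlMl//.
apply: ereal_inf_lbound; exists (fun k => @scaleRn R n e @^-1` G k).
  split=> [k|x /= /BG [k _ Gk]]; last by exists k.
  by rewrite -[X in measurable X]setTI; exact: measurable_scaleRn_borel.
rewrite -nneseriesZl//; apply: eq_eseriesr => k _.
by rewrite borel_lebesgue_scale// exprVn.
Qed.

(** The Caratheodory criterion for the preimage of A, tested against X, is the
    criterion for A, tested against c X, multiplied by c^-n. *)
Lemma measurable_scaleRn c : (0 < c)%R ->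
  measurable_fun setT (@scaleRn R n c : Rn R n -> Rn R n).
Proof.
move=> c0 _ A mA; rewrite setTI.
suff : caratheodory_measurable mu_ext (@scaleRn R n c @^-1` A) by [].
move=> X; have V0 : (0 < c^-1)%R by rewrite invr_gt0.
rewrite -(preimage_scaleRnK X (lt0r_neq0 V0)) invrK.
rewrite preimage_setC -!preimage_setI !(mu_ext_scale _ c0).
rewrite -ge0_muleDr; [|exact: mu_ext_ge0..].
by congr (_ * _); exact: mA.
Qed.

Lemma lebesgueRn_scale c (A : set (Rn R n)) : (0 < c)%R ->
  lebesgueRn ((@scaleRn R n c : Rn R n -> Rn R n) @^-1` A) =
  (c^-1 ^+ n)%:E * lebesgueRn A.
Proof. exact: mu_ext_scale. Qed.
End lebesgueRn_scale.

Section integral_scale.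
Context {R : realType} {n : nat}.

Import HBNNSimple.

Local Notation S := (@scaleRn R n : R -> Rn R n -> Rn R n).

(** As for [ge0_integralZ], it suffices to prove <= for c and c^-1.  A simple
    function h below f o S c is h' o S c for the simple function h' = h o S c^-1
    below f, and the law holds for h' because the image of Lebesgue measure under
    S c is c^-n times Lebesgue measure. *)
Lemma ge0_integral_scale (c : R) (f : Rn R n -> \bar R) : (0 < c)%R ->
    (forall x, 0 <= f x) ->
  \int[@lebesgueRn R n]_x f (S c x) =
  (c^-1 ^+ n)%:E * \int[@lebesgueRn R n]_x f x.
Proof.
move=> c0 f0.
have eq_h (e : R) (h : {nnsfun Rn R n >-> R}) : (0 < e)%R ->
    \int[@lebesgueRn R n]_x (h (S e x))%:E =
    (e^-1 ^+ n)%:E * \int[@lebesgueRn R n]_x (h x)%:E.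
  move=> e0; have k0 : (0 <= e^-1 ^+ n)%R by rewrite exprn_ge0// invr_ge0 ltW.
  pose k : {nonneg R} := NngNum k0.
  have mh : measurable_fun setT (EFin \o h) by exact/measurable_EFinP.
  have h0 x : 0 <= (EFin \o h) x by rewrite lee_fin.
  rewrite -[LHS](@ge0_integral_pushforward _ _ _ _ _ _
    (measurable_scaleRn e0) _ setT (EFin \o h))//.
  rewrite (@eq_measure_integral _ _ _ _ (mscale k (@lebesgueRn R n))); last first.
  - by move=> mS B mB _; rewrite /mscale /= /pushforward lebesgueRn_scale.
  - exact: measurable_scaleRn.
  - by rewrite ge0_integral_mscale.
have S0 (e : R) x : (0 < e)%R -> S e (S e^-1%R x) = x.
  by move=> e0; rewrite -{1}(invrK e) scaleRnK// invr_eq0 gt_eqF.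
have le_f (e : R) g : (0 < e)%R -> (forall x, 0 <= g x) ->
    \int[@lebesgueRn R n]_x g (S e x) <=
    (e^-1 ^+ n)%:E * \int[@lebesgueRn R n]_x g x.
  move=> e0 g0; apply: ge0_integral_le_nnsfun => // h hg.
  have en0 : (0 < e ^+ n)%R by rewrite exprn_gt0.
  rewrite exprVn lee_pdivlMl//.
  have V0 : (0 < e^-1)%R by rewrite invr_gt0.
  rewrite -{1}(invrK e) -eq_h//; apply: ge0_integral_mono => x.
    by rewrite lee_fin.
  by apply: le_trans (hg _) _; rewrite S0.
apply/eqP; rewrite eq_le le_f//=.
have cn0 : (0 < c ^+ n)%R by rewrite exprn_gt0.
rewrite exprVn lee_pdivrMl//.
have -> : \int[@lebesgueRn R n]_x f x =
    \int[@lebesgueRn R n]_x (f \o S c) (S c^-1%R x).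
  by apply: eq_integral => x _; rewrite /= S0.
have := le_f c^-1%R (f \o S c); rewrite invrK; apply => [|x].
- by rewrite invr_gt0.
- exact: f0.
Qed.

End integral_scale.

(** * Powers in [0, +oo] *)

Section epow_theory.
Context {R : realType}.
Implicit Types (x : \bar R) (r s k : R).

Lemma epow_ge0 x r : 0 <= epow x r.
Proof. by rewrite /epow; case: ifP => _; rewrite ?inve_ge0 poweR_ge0. Qed.

Lemma epowZ k x r : (0 < k)%R -> 0 <= x ->
  epow (k%:E * x) r = (k `^ r)%:E * epow x r.
Proof.
move=> k0 x0; rewrite /epow; case: ifP => r0.
  rewrite poweRM ?lee_fin ?(ltW k0)//.
  have kr : (0 < k `^ (- r))%R by rewrite powR_gt0.
  rewrite inveM; first by rewrite poweR_EFin inver gt_eqF// -powRN opprK.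
  rewrite inveM_defE !poweR_ge0 poweR_EFin eqe gt_eqF//= ltry.
  by rewrite lte_fin kr !implybT.
by rewrite poweRM ?lee_fin ?(ltW k0).
Qed.

Lemma epowNE x r : (0 < r)%R -> epow x (- r)%R = (epow x r)^-1.
Proof. by move=> r0; rewrite /epow oppr_lt0 r0 opprK ltNge (ltW r0). Qed.

(** The conventions agree at the ends of [0, +oo]: for r < 0 both sides are +oo
    at x = 0 and 0 at x = +oo.  This is what lets the transform of phi be handled
    where the Laplace transform is infinite. *)
Lemma expeR_lne x r : r != 0%R -> 0 <= x -> expeR (r%:E * lne x) = epow x r.
Proof.
suff pos (s : R) : (0 < s)%R -> 0 <= x -> expeR (s%:E * lne x) = epow x s.
  move=> r_neq0 x0; have [r0|r0|r0] := ltgtP r 0%R;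
    [|exact: pos|by rewrite r0 eqxx in r_neq0].
  have s0 : (0 < - r)%R by rewrite oppr_gt0.
  rewrite -[in RHS](opprK r) epowNE// -pos// EFinN mulNe.
  case: (_ * _) => [t| |] /=; rewrite ?invey ?inve0//.
  by rewrite inver expR_eq0 expRN invrK.
move=> s0; rewrite /epow ltNge (ltW s0)/=; case: x => [t||//].
- rewrite lee_fin le_eqVlt => /predU1P[<-|t0].
    by rewrite le0_lneNy// poweR0r ?gt_eqF// mulrNy gtr0_sg// mul1e.
  by rewrite lne_EFin//= /powR gt_eqF.
- by move=> _; rewrite mulry gtr0_sg// mul1e/= gt_eqF.
Qed.

End epow_theory.

(** * The L^p-Legendre transform of phi as a Laplace transform of F *)

Section legendre_laplace.
Context {R : realType} {n : nat}.
Variables (a p : R) (F : Rn R n -> R) (phi : Rn R n -> \bar R).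
Hypotheses (a_gt0 : (0 < a)%R) (F_ge0 : forall x, (0 <= F x)%R).
Hypothesis phi_def : forall x, phi x = - (a%:E * lne (F x)%:E).

Local Notation S := (@scaleRn R n : R -> Rn R n -> Rn R n).

Lemma dotRn_scale (c : R) (x y : Rn R n) :
  dotRn x (S c y) = (c * dotRn x y)%R.
Proof.
rewrite /dotRn mulr_sumr; apply: eq_bigr => i _.
by rewrite tnth_map mulrCA.
Qed.

Lemma expeRN_phi x : expeR (- phi x) = (F x `^ a)%:E.
Proof.
by rewrite phi_def oppeK expeR_lne ?gt_eqF ?lee_fin// /epow ltNge (ltW a_gt0).
Qed.

Lemma volume_phi : volume phi = \int[@lebesgueRn R n]_x epow (F x)%:E a.
Proof.
by apply: eq_integral => x _; rewrite expeRN_phi /epow ltNge (ltW a_gt0).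
Qed.

(** Where F x = 0 both sides vanish.  Elsewhere the two powers of F x have total
    exponent a p + a = 1. *)
Lemma legendre_integrand (v : R) x y :
    (0 < p)%R -> (a * (p + 1))%R = 1%R -> (0 < v)%R ->
  expeR (p%:E * ((dotRn x y)%:E - phi x)) * (expeR (- phi x) / v%:E) =
  v^-1%:E * (F x * expR (dotRn x (S p y)))%:E.
Proof.
move=> p0 ap1 v0; rewrite dotRn_scale expeRN_phi inver gt_eqF// phi_def oppeK.
have := F_ge0 x; rewrite le_eqVlt => /predU1P[<-|Fx0].
  by rewrite powR0 ?gt_eqF// mul0r !mul0e !mule0.
rewrite lne_EFin// /powR gt_eqF// -!(EFinM, EFinD) /=; congr EFin.
rewrite mulrA -expRD mulrC; congr (_ * _)%R.
rewrite -[in RHS](lnK (Fx0 : F x \is Num.pos)) -expRD; congr expR.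
by rewrite -[in RHS](mul1r (ln (F x))) -ap1; ring.
Qed.

Lemma expeRN_Lp_legendre (v : R) y :
    (0 < p)%R -> (a * (p + 1))%R = 1%R -> (0 < v)%R -> volume phi = v%:E ->
  expeR (- Lp_legendre p phi y) =
  (v `^ p^-1)%:E * epow (laplace F (S p y)) (- p^-1)%R.
Proof.
move=> p0 ap1 v0 Vv; rewrite /Lp_legendre Vv.
under eq_integral do rewrite legendre_integrand//.
have LF0 x z : 0 <= (F x * expR (dotRn x z))%:E.
  by rewrite lee_fin mulr_ge0// expR_ge0.
have v'0 : (0 < v^-1)%R by rewrite invr_gt0.
have p'0 : (p^-1 != 0)%R by rewrite invr_eq0 gt_eqF.
have L0 : 0 <= laplace F (S p y) by exact: integral_ge0.
rewrite ge0_integralZ// -[X in lne (_ * X)]/(laplace F (S p y)).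
rewrite -mulNe -EFinN expeR_lne ?oppr_eq0//; last first.
  by rewrite mule_ge0// lee_fin ltW.
rewrite epowZ//.
by congr (_%:E * _); rewrite -powR_inv1 ?ltW// -powRrM mulN1r opprK.
Qed.

(** The factor p^-n comes from substituting y / p for y in the integral of
    [expeRN_Lp_legendre]. *)
Lemma mahler_laplace (v : R) :
    (0 < p)%R -> (a * (p + 1))%R = 1%R -> (0 < v)%R -> volume phi = v%:E ->
  mahler p phi =
  (v * (v `^ p^-1 * p^-1 ^+ n))%:E *
  \int[@lebesgueRn R n]_y epow (laplace F y) (- p^-1)%R.
Proof.
move=> p0 ap1 v0 Vv; rewrite /mahler Vv EFinM -muleA; congr (_ * _).
rewrite EFinM -muleA -ge0_integral_scale//; last by move=> x; exact: epow_ge0.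
rewrite -ge0_integralZ ?powR_gt0//; last by move=> x; exact: epow_ge0.
by apply: eq_integral => y _; exact: expeRN_Lp_legendre.
Qed.

End legendre_laplace.

Lemma int_powR_gt0 (R : realType) (n : nat) (a : R) (F : Rn R n -> R) :
    (0 < a)%R -> measurable_fun [set: Rn R n] F -> (forall x, (0 <= F x)%R) ->
    ~ {ae (@lebesgueRn R n), forall x, F x = 0%R} ->
  0 < \int[@lebesgueRn R n]_x (F x `^ a)%:E.
Proof.
move=> a0 mF F0 nF; rewrite lt_neqAle integral_ge0 ?andbT; last first.
  by move=> x _; rewrite lee_fin powR_ge0.
apply/eqP => I0; apply: nF.
have mFa : measurable_fun [set: Rn R n] (fun x => (F x `^ a)%:E).
  by apply/measurable_EFinP; apply: (measurableT_comp (measurable_powR a) mF).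
have [+ _] := ae_eq_integral_abs (@lebesgueRn R n) measurableT mFa.
under eq_integral do rewrite gee0_abs ?lee_fin ?powR_ge0//.
move=> /(_ (esym I0)); apply: filterS => x /(_ I) /= [] /eqP.
by rewrite powR_eq0 => /andP[/eqP].
Qed.

Theorem lemma1p13 (R : realType) (n : nat) (a p : R)
    (a_gt0 : (0 < a)%R) (a_lt1 : (a < 1)%R) (p_def : p = ((1 - a) / a)%R)
    (F : Rn R n -> R)
    (F_meas : measurable_fun [set: Rn R n] F)
    (F_ge0 : forall x, (0 <= F x)%R)
    (F_La : normL a (EFin \o F) < +oo)
    (F_neq0 : ~ {ae (@lebesgueRn R n), forall x, F x = 0%R})
    (phi : Rn R n -> \bar R)
    (phi_def : forall x, phi x = - (a%:E * lne (F x)%:E)) :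
  normL a (EFin \o F) / normL (a / (a - 1))%R (laplace F) =
  (p `^ (n%:R * p))%:E * epow (mahler p phi) p.
Proof.
have p0 : (0 < p)%R by rewrite p_def divr_gt0// subr_gt0.
have ap1 : (a * (p + 1))%R = 1%R by rewrite p_def; field; rewrite gt_eqF.
have a'E : (a^-1 = p + 1)%R by rewrite p_def; field; rewrite gt_eqF.
have aE : (a / (a - 1) = - p^-1)%R.
  rewrite p_def; field.
  by rewrite !subr_eq0 (gt_eqF a_gt0) (lt_eqF a_lt1) (gt_eqF a_lt1).
have VE := volume_phi a_gt0 F_ge0 phi_def.
have V0 : 0 < volume phi.
  rewrite VE; under eq_integral do rewrite /epow ltNge (ltW a_gt0)/=.
  exact: int_powR_gt0.
have Voo : volume phi < +oo.
  move: F_La; rewrite /normL /= -VE /epow (ltNge a^-1%R) invr_ge0 (ltW a_gt0)/=.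
  by apply: lty_poweRy; rewrite invr_eq0 gt_eqF.
have [v Vv] : exists v : R, volume phi = v%:E.
  by exists (fine (volume phi)); rewrite fineK// ge0_fin_numE ?ltW.
have v0 : (0 < v)%R by rewrite -lte_fin -Vv.
rewrite (mahler_laplace a_gt0 F_ge0 phi_def p0 ap1 v0 Vv) /normL /= -VE Vv aE.
rewrite invrN invrK epowNE// inveK epowZ; last 2 first.
- by rewrite !mulr_gt0 ?powR_gt0 ?exprn_gt0 ?invr_gt0.
- by apply: integral_ge0 => y _; exact: epow_ge0.
rewrite muleA -EFinM a'E /epow (ltNge (p + 1)%R) addr_ge0 ?(ltW p0)//=.
(* What remains is v^(p + 1) = p^(n p) (v (v^(1/p) p^(-n)))^p. *)
congr (_%:E * _).
rewrite powRM ?ltW ?mulr_gt0 ?powR_gt0 ?exprn_gt0 ?invr_gt0//.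
rewrite powRM ?ltW ?powR_gt0 ?exprn_gt0 ?invr_gt0//.
rewrite -powRrM mulVf ?gt_eqF// -powR_mulrn ?invr_ge0 ?ltW//.
rewrite -powR_inv1 ?ltW// -!powRrM mulN1r powRN.
rewrite powRD; last by rewrite (gt_eqF v0) implybT.
by field; rewrite gt_eqF ?powR_gt0.
Qed.
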